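(* Let $\mathcal A : H_1 \to H_2$ be a Hilbert--Schmidt operator with singular values $\sigma_1\ge\sigma_2\ge\cdots\ge 0$ and left singular vectors $u_1,u_2,\ldots$. Let $y_1,\dots,y_{k+p}$ be the random vectors $y_j = \sum_i \omega_{ij}\sigma_i u_i$ with $\omega_{ij}$ i.i.d. $\mathcal N(0,1)$, let $Y=[y_1,\dots,y_{k+p}]$, let $\Omega_k=[\omega_{ij}]\in\mathbb R^{k\times(k+p)}$, $i=1,\ldots,k$, $j=1,\ldots,k+p$, and let $\widehat{\mathcal A} = QQ^*\mathcal A$, where $Q$ is an orthonormal basis of $\mathrm{range}(Y)$. Then, almost surely, $$\|\mathcal A-\widehat{\mathcal A}\|_{\mathrm{HS}}^2 \le \sum_{i>k}\sigma_i^2 + \|(\mathrm{Id}-U_kU_k^* )Y\Omega_k^\dagger\|_{\mathrm{HS}}^2,$$ where $U_k=[u_1,\dots,u_k]$.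
   Context: $H_1,H_2$ are real, separable, infinite-dimensional Hilbert spaces. $\|\cdot\|_{\mathrm{HS}}$ is the Hilbert--Schmidt norm. A Hilbert--Schmidt operator $\mathcal A$ has a singular value decomposition $\mathcal A=\sum_{i\ge1}\sigma_i\langle v_i,\cdot\rangle_{H_1}u_i$ with $\sigma_1\ge\sigma_2\ge\dots\ge0$ and orthonormal systems $\{u_i\}$ in $H_2$ (left singular vectors) and $\{v_i\}$ in $H_1$ (right singular vectors). A quasi-matrix $F=[f_1,\dots,f_r]$ with columns $f_i$ in a Hilbert space $H$ is identified with the operator $\mathbb R^r\to H$, $\xi\mapsto\sum_i\xi_if_i$; its adjoint is $F^*f=(\langle f_i,f\rangle_H)_{i=1}^r$. $k\ge1$ and $p\ge0$ are integers (target rank and oversampling parameter). The series $y_j=\sum_i\omega_{ij}\sigma_iu_i$ converges almost surely in $H_2$, and the $y_j$ are i.i.d. with distribution $\mathcal N_{H_2}(0,\mathcal A\mathcal A^* )$, the centered Gaussian measure on $H_2$ with covariance operator $\mathcal A\mathcal A^*$. $QQ^*$ is the orthogonal projector onto $\mathrm{range}(Y)=\mathrm{span}\{y_1,\dots,y_{k+p}\}$. $\Omega_k^\dagger$ is the Moore--Penrose pseudoinverse of $\Omega_k$. *)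

(* Defs.v *)
From HB Require Import structures.
From mathcomp Require Import all_boot all_order all_algebra sesquilinear.
From mathcomp Require Import finmap.
From mathcomp Require Import all_classical all_reals all_analysis.

Set Implicit Arguments.
Unset Strict Implicit.
Unset Printing Implicit Defensive.

Import Order.TTheory GRing.Theory Num.Theory.
Import numFieldNormedType.Exports.

Local Open Scope classical_set_scope.
Local Open Scope ring_scope.

(* The inner product is kept apart from the norm because the normed module
   structure of 'cV[R]_n in the library is the sup norm, whereas R^n has to
   carry the Euclidean inner product. *)
HB.mixin Record hasInner (R : realType) (V : Type) of GRing.Lmodule R V := {
  inner : {dot V for idfun}
}.

#[short(type="innerType")]
HB.structure Definition InnerSpace (R : realType) :=
  {V of GRing.Lmodule R V & hasInner R V}.

Notation "''[' u , v ]" := (inner u%R v%R) : ring_scope.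

HB.mixin Record isHilbert (R : realType) (H : Type)
    of CompleteNormedModule R H & InnerSpace R H := {
  sqr_norm_inner : forall x : H, `|x| ^+ 2 = '[x, x]
}.

#[short(type="hilbertType")]
HB.structure Definition Hilbert (R : realType) :=
  {H of CompleteNormedModule R H & InnerSpace R H & isHilbert R H}.

Section euclidean.
Context {R : realType} {n : nat}.
Implicit Types u v : 'cV[R]_n.

Definition cv_inner u v : R := \sum_(i < n) u i 0 * v i 0.

Let cv_inner_bilinear : bilinear_for *%R (idfun \; *%R) cv_inner.
Proof.
split=> [v|u] a x y; rewrite /cv_inner /= mulr_sumr -big_split /=;
  apply: eq_bigr => i _; rewrite !mxE.
  by rewrite mulrDl mulrA.
by rewrite mulrDr mulrCA.
Qed.

HB.instance Definition _ :=
  bilinear_isBilinear.Build R _ _ _ _ _ cv_inner cv_inner_bilinear.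

Let cv_inner_sym u v : cv_inner u v = (-1) ^+ false * idfun (cv_inner v u).
Proof. by rewrite mul1r; apply: eq_bigr => i _; rewrite mulrC. Qed.

HB.instance Definition _ :=
  isHermitianSesquilinear.Build R _ false idfun cv_inner cv_inner_sym.

Let cv_inner_gt0 u : u != 0 -> 0 < cv_inner u u.
Proof.
move=> u0; have ge0 i : true -> 0 <= u i 0 * u i 0 by rewrite -expr2 sqr_ge0.
rewrite lt_neqAle sumr_ge0// andbT eq_sym; apply: contraNneq u0.
move/eqP; rewrite psumr_eq0// => /allP u0; apply/eqP/matrixP => i j.
by rewrite ord1 mxE; apply/eqP; have := u0 i (mem_index_enum _); rewrite mulf_eq0 orbb.
Qed.

HB.instance Definition _ := isDotProduct.Build R _ cv_inner cv_inner_gt0.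

HB.instance Definition _ :=
  hasInner.Build R 'cV[R]_n (cv_inner : {dot 'cV[R]_n for idfun}).

End euclidean.

Definition separable (T : topologicalType) :=
  exists2 D : set T, countable D & dense D.

Section orthonormal.
Context {R : realType}.

Definition orthonormal_family (V : innerType R) (I : eqType) (f : I -> V) :=
  forall i j, '[f i, f j] = (i == j)%:R.

(* Maximal orthonormal sets, of arbitrary cardinality. *)
Definition orthonormal_basis (V : innerType R) (B : set V) :=
  (forall x y, B x -> B y -> '[x, y] = (x == y)%:R) /\
  (forall x, (forall b, B b -> '[b, x] = 0) -> x = 0).

(* For a bounded operator T between Hilbert spaces \sum_(b in B) ||T b||^2 does
   not depend on the orthonormal basis B: the supremum is over one value. *)
Definition hs_norm (V : innerType R) (W : normedModType R) (T : V -> W) :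
    \bar R :=
  sqrte (ereal_sup [set \esum_(b in B) (`|T b| ^+ 2)%:E
                   | B in @orthonormal_basis V]).

Definition hilbert_schmidt (V : hilbertType R) (W : normedModType R)
  (T : V -> W) := continuous T /\ (hs_norm T < +oo)%E.

End orthonormal.

Arguments hs_norm {R V W} T%_R.

Section quasimatrix.
Context {R : realType} {H : innerType R} {r : nat}.

(* The quasi-matrix F = [f_1, ..., f_r] as an operator, and its adjoint. *)
Definition qop (F : 'I_r -> H) (xi : 'cV[R]_r) : H := \sum_i xi i 0 *: F i.

Definition qadj (F : 'I_r -> H) (f : H) : 'cV[R]_r := \col_i '[F i, f].

End quasimatrix.

Definition infinite_dimensional (R : realType) (H : innerType R) :=
  forall n (f : 'I_n -> H), range (qop f) != setT.

(* Numbered from 0: sigma 0 is the largest singular value. *)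
Record svd (R : realType) (H1 H2 : hilbertType R) (A : H1 -> H2)
    (sigma : nat -> R) (u : nat -> H2) (v : nat -> H1) : Prop := {
  svd_ge0 : forall i, 0 <= sigma i ;
  svd_noninc : {homo sigma : i j / (i <= j)%N >-> j <= i} ;
  svd_left : orthonormal_family u ;
  svd_right : orthonormal_family v ;
  svdE : forall x, series (fun i => (sigma i * '[v i, x]) *: u i) @ \oo --> A x
}.

Section pseudoinverse.
Context {R : realType}.

Definition moore_penrose m n (A : 'M[R]_(m, n)) (X : 'M[R]_(n, m)) : Prop :=
  [/\ A *m X *m A = A, X *m A *m X = X,
      (A *m X)^T = A *m X & (X *m A)^T = X *m A].

Definition mp_inverse m n (A : 'M[R]_(m, n)) : 'M[R]_(n, m) :=
  xget 0 (moore_penrose A).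

Let gram_unitmx m n (B : 'M[R]_(m, n)) : row_free B -> B *m B^T \in unitmx.
Proof.
move=> Bfree; rewrite -row_free_unit -kermx_eq0; apply/rowV0P => x.
move=> /sub_kermxP xBB; apply/(row_free_inj Bfree)/rowP => j.
rewrite mul0mx [RHS]mxE; apply/eqP.
have : (x *m B *m (x *m B)^T) 0 0 = 0.
  by rewrite trmx_mul mulmxA -(mulmxA x) xBB mul0mx mxE.
move=> /eqP; rewrite mxE psumr_eq0 => [/allP/(_ j (mem_index_enum _))|i _].
  by rewrite [in X in _ * X]mxE mulf_eq0 orbb.
by rewrite [in X in _ * X]mxE -expr2 sqr_ge0.
Qed.

Lemma moore_penrose_ex m n (A : 'M[R]_(m, n)) : exists X, moore_penrose A X.
Proof.
have [r [C [D [AE]]]] : exists (r : nat) (C : 'M[R]_(m, r)) (D : 'M[R]_(r, n)),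
    [/\ A = C *m D, row_full C & row_free D].
  exists (\rank A), (col_base A), (row_base A).
  by rewrite mulmx_base col_base_full row_base_free.
move=> Cfull Dfree.
have uD : D *m D^T \in unitmx by exact: gram_unitmx.
have uC : C^T *m C \in unitmx.
  by rewrite -{2}[C]trmxK; apply: gram_unitmx; rewrite /row_free mxrank_tr.
pose U := invmx (D *m D^T); pose W := invmx (C^T *m C).
have DU : D *m (D^T *m U) = 1%:M by rewrite mulmxA mulmxV.
have WC : W *m C^T *m C = 1%:M by rewrite -mulmxA mulVmx.
have trU : U^T = U by rewrite /U trmx_inv trmx_mul trmxK.
have trW : W^T = W by rewrite /W trmx_inv trmx_mul trmxK.
exists (D^T *m U *m (W *m C^T)).
have AX : A *m (D^T *m U *m (W *m C^T)) = C *m (W *m C^T).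
  by rewrite AE -!mulmxA (mulmxA D) (mulmxA (D *m D^T)) mulmxV// mul1mx.
have XA : D^T *m U *m (W *m C^T) *m A = D^T *m U *m D.
  by rewrite AE -!mulmxA; do 2 congr (_ *m _); rewrite !mulmxA WC mul1mx.
split.
- by rewrite AX AE -!mulmxA; congr (_ *m _); rewrite !mulmxA WC mul1mx.
- rewrite XA -!mulmxA; do 2 congr (_ *m _).
  by rewrite (mulmxA D) (mulmxA (D *m D^T)) mulmxV// mul1mx.
- by rewrite AX !trmx_mul trmxK trW mulmxA.
- by rewrite XA !trmx_mul trmxK trU mulmxA.
Qed.

Lemma mp_inverseP m n (A : 'M[R]_(m, n)) : moore_penrose A (mp_inverse A).
Proof. by have [X AX] := moore_penrose_ex A; exact: (xgetI 0 AX). Qed.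

Lemma moore_penrose_uniq m n (A : 'M[R]_(m, n)) X Y :
  moore_penrose A X -> moore_penrose A Y -> X = Y.
Proof.
move=> [a1 a2 a3 a4] [b1 b2 b3 b4].
have AXY : A *m X = A *m Y.
  by rewrite -a3 -{1}b1 -mulmxA trmx_mul a3 b3 mulmxA a1.
have XAY : X *m A = Y *m A.
  rewrite -a4 -[in LHS]b1 -mulmxA mulmxA trmx_mul b4 a4.
  by rewrite mulmxA -(mulmxA Y) -mulmxA a1.
by rewrite -a2 XAY -mulmxA AXY mulmxA b2.
Qed.

End pseudoinverse.

Section probability.
Context {d : measure_display} {T : measurableType d} {R : realType}.
Variable P : probability T R.

Definition mutually_independent (I : choiceType) (X : I -> {RV P >-> R}) :=
  forall (S : {fset I}) (B : I -> set R), (forall i, measurable (B i)) ->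
  P (\bigcap_(i in [set` S]) (X i @^-1` B i)) =
  (\prod_(i <- S) P (X i @^-1` B i))%E.

Definition standard_normal (X : {RV P >-> R}) :=
  forall B : set R, measurable B -> distribution P X B = normal_prob 0 1 B.

Definition iid_standard_normal (I : choiceType) (X : I -> {RV P >-> R}) :=
  mutually_independent X /\ (forall i, standard_normal (X i)).

(* Column j is the limit of the series \sum_i omega_ij sigma_i u_i, which
   converges almost surely; it is an arbitrary value where it diverges. *)
Definition sketch (H : hilbertType R) (l : nat)
    (omega : nat * 'I_l -> {RV P >-> R}) (sigma : nat -> R) (u : nat -> H)
    (w : T) : 'I_l -> H :=
  fun j => limn (series (fun i => (omega (i, j) w * sigma i) *: u i)).

Definition omega_mx (k l : nat) (omega : nat * 'I_l -> {RV P >-> R}) (w : T) :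
    'M[R]_(k, l) :=
  \matrix_(i < k, j < l) omega (i : nat, j) w.

End probability.

(* Main.v *)
(* Almost surely the k leading rows Omega of the Gaussian array have full row
   rank, so that Omega X = 1 for its pseudoinverse X, and the z_i = Y X e_i
   (i < k) satisfy <u_m, z_i> = sigma_i [m = i] for m < k; hence
   z_i = sigma_i u_i + w_i with w_i = (Id - U U^* ) Y X e_i.  The projector
   Pi = Id - Q Q^* kills z_i because z_i lies in the range of Y, so
   |sigma_i Pi u_i| = |Pi w_i| <= |w_i| for i < k, while |sigma_i Pi u_i| <=
   sigma_i for i >= k.  It remains to see that ||Pi A||_HS^2 is at most
   \sum_i |sigma_i Pi u_i|^2.  Instead of Parseval in H2, this uses that the
   entrywise product of two Gram matrices has a nonnegative sum of entries. *)

Require Import Defs.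
From HB Require Import structures.
From mathcomp Require Import all_boot all_order all_algebra sesquilinear.
From mathcomp Require Import finmap.
From mathcomp Require Import all_classical all_reals all_analysis.
From mathcomp Require Import measurable_realfun.
From mathcomp Require Import ring lra.

Set Implicit Arguments.
Unset Strict Implicit.
Unset Printing Implicit Defensive.

Import Order.TTheory GRing.Theory Num.Theory.
Import numFieldNormedType.Exports.

Local Open Scope classical_set_scope.
Local Open Scope ring_scope.

(** * Bilinear calculus in inner product spaces *)

Section inner_space.
Context {R : realType} {V : innerType R}.
Implicit Types x y z : V.

Lemma innerC x y : '[x, y] = '[y, x].
Proof. by rewrite hermC expr0 mul1r. Qed.

Lemma innerDl x y z : '[x + y, z] = '[x, z] + '[y, z].
Proof. by rewrite linearDl. Qed.

Lemma innerDr x y z : '[z, x + y] = '[z, x] + '[z, y].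
Proof. by rewrite linearDr. Qed.

Lemma innerBl x y z : '[x - y, z] = '[x, z] - '[y, z].
Proof. by rewrite linearBl. Qed.

Lemma innerBr x y z : '[z, x - y] = '[z, x] - '[z, y].
Proof. by rewrite linearBr. Qed.

Lemma innerZl (a : R) x y : '[a *: x, y] = a * '[x, y].
Proof. by rewrite linearZl_LR. Qed.

Lemma innerZr (a : R) x y : '[x, a *: y] = a * '[x, y].
Proof. by rewrite innerC innerZl innerC. Qed.

Lemma inner_suml I (s : seq I) (P : pred I) (F : I -> V) x :
  '[\sum_(i <- s | P i) F i, x] = \sum_(i <- s | P i) '[F i, x].
Proof. by rewrite linear_sumlz. Qed.

Lemma inner_sumr I (s : seq I) (P : pred I) (F : I -> V) x :
  '[x, \sum_(i <- s | P i) F i] = \sum_(i <- s | P i) '[x, F i].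
Proof. by rewrite linear_sumr. Qed.

Lemma inner_ge0 x : 0 <= '[x, x].
Proof.
have [->|x0] := eqVneq x 0; first by rewrite linear0l.
exact/ltW/(@neq0_dnorm_gt0 _ _ _ inner).
Qed.

Lemma inner_eq0 x : '[x, x] = 0 -> x = 0.
Proof.
move=> xx0; apply: contrapT => /eqP /(@neq0_dnorm_gt0 _ _ _ inner).
by rewrite xx0 ltxx.
Qed.

End inner_space.

(** * Gram matrices and a Bessel-type inequality *)

(** The sum is the squared norm of the tensor $\sum_i a_i \otimes c_i$. The induction keeps [c]
    general, since each step replaces it by [c']. *)
Lemma gram_mul_ge0 (R : realType) (V W : innerType R) (I : Type) (s : seq I)
    (a : I -> V) (c : I -> W) :
  0 <= \sum_(i <- s) \sum_(j <- s) '[a i, a j] * '[c i, c j].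
Proof.
elim: s c => [|i0 s IH] c; first by rewrite big_nil.
(* If [n] is 0 then so is [c i0], and the value of the division by zero does no harm. *)
pose n := '[c i0, c i0]; pose t i := '[c i0, c i] / n.
have nt i : '[c i0, c i] = t i * n.
  rewrite /t; have [n0|n0] := eqVneq n 0; last by rewrite divfK.
  by rewrite (inner_eq0 n0) linear0l !mul0r.
pose c' i := c i - t i *: c i0.
have c'0 : c' i0 = 0.
  rewrite /c' /t -/n; have [n0|n0] := eqVneq n 0; last first.
    by rewrite divff// scale1r subrr.
  by rewrite (inner_eq0 n0) scaler0 subr0.
(* One step of Cholesky elimination: the rank-one part t t^T n is split off the
   Gram matrix of c, and c' vanishes at i0. *)
have cE i j : '[c i, c j] = '[c' i, c' j] + t i * t j * n.
  rewrite /c' innerBl !innerBr !innerZl !innerZr (innerC (c i) (c i0)) -/n !nt.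
  ring.
have -> : \sum_(i <- i0 :: s) \sum_(j <- i0 :: s) '[a i, a j] * '[c i, c j] =
  \sum_(i <- s) \sum_(j <- s) '[a i, a j] * '[c' i, c' j] +
  n * '[\sum_(i <- i0 :: s) t i *: a i, \sum_(i <- i0 :: s) t i *: a i].
  under eq_bigr do under eq_bigr do rewrite cE mulrDr.
  under eq_bigr do rewrite big_split/=.
  rewrite big_split/=; congr (_ + _).
    rewrite big_cons big1 ?add0r => [|i _]; last by rewrite c'0 linear0l mulr0.
    by apply: eq_bigr => i _; rewrite big_cons c'0 linear0r mulr0 add0r.
  rewrite inner_suml mulr_sumr; apply: eq_bigr => i _.
  rewrite inner_sumr mulr_sumr; apply: eq_bigr => j _.
  by rewrite innerZl innerZr; ring.
by rewrite addr_ge0 ?IH// mulr_ge0 ?inner_ge0.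
Qed.

(** The right side minus the left is $\sum_{i,j}\langle a_i,a_j\rangle\langle c_i,c_j\rangle$, with
    $a_i$ the part of [v i] orthogonal to [F]. The [c i] are arbitrary because they will be
    projections of orthogonal vectors. *)
Lemma orthonormal_sum_le (R : realType) (V W : innerType R) (v : nat -> V)
    (c : nat -> W) (F : seq V) n :
  orthonormal_family v -> uniq F ->
  {in F &, forall x y : V, '[x, y] = (x == y)%:R} ->
  \sum_(b <- F) '[\sum_(i < n) '[v i, b] *: c i, \sum_(i < n) '[v i, b] *: c i]
    <= \sum_(i < n) '[c i, c i].
Proof.
move=> v1 uF F1.
(* The components of the v i orthogonal to F: their Gram matrix is the identity
   minus the Gram matrix of the projections. *)
pose a (i : 'I_n) := v i - \sum_(b <- F) '[v i, b] *: b.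
have bS i b : b \in F -> '[b, \sum_(b <- F) '[v i, b] *: b] = '[v i, b].
  move=> bF; rewrite inner_sumr (bigD1_seq b)//= innerZr F1// eqxx mulr1.
  rewrite big_seq_cond big1 ?addr0// => b' /andP[b'F bb'].
  by rewrite innerZr F1// eq_sym (negbTE bb') mulr0.
have aE i j : '[a i, a j] = (i == j)%:R - \sum_(b <- F) '[v i, b] * '[v j, b].
  rewrite /a innerBl !innerBr v1 -addrA; congr (_ + _).
  rewrite [X in _ - (_ - X)]inner_suml [in X in _ - (_ - X)]big_seq.
  under [X in _ - (_ - X)]eq_bigr => b bF do rewrite innerZl bS//.
  rewrite -big_seq inner_suml.
  under [X in _ - (X - _)]eq_bigr => b _ do rewrite innerZl (innerC b).
  by rewrite subrr subr0 inner_sumr; congr (- _); apply: eq_bigr => b _;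
    rewrite innerZr mulrC.
rewrite -subr_ge0.
suff <- : \sum_(i < n) \sum_(j < n) '[a i, a j] * '[c i, c j] =
  \sum_(i < n) '[c i, c i] -
  \sum_(b <- F) '[\sum_(i < n) '[v i, b] *: c i, \sum_(i < n) '[v i, b] *: c i].
  exact: (gram_mul_ge0 _ a (fun i : 'I_n => c i)).
under eq_bigr do under eq_bigr do rewrite aE mulrBl.
under eq_bigr do rewrite sumrB.
rewrite sumrB; congr (_ - _).
  apply: eq_bigr => i _; rewrite (bigD1 i)//= eqxx mul1r big1 ?addr0// => j.
  by rewrite eq_sym => /negbTE ->; rewrite mul0r.
under [RHS]eq_bigr => b _.
  rewrite inner_suml; under eq_bigr do rewrite inner_sumr.
  over.
rewrite [RHS]exchange_big/=; apply: eq_bigr => i _.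
rewrite [RHS]exchange_big/=; apply: eq_bigr => j _.
by rewrite mulr_suml; apply: eq_bigr => b _; rewrite innerZl innerZr mulrA.
Qed.

(** * The complementary projector and its continuity *)

(** Polarization reduces the claim to the continuity of the norm. *)
Lemma inner_cvgr (R : realType) (H : hilbertType R) (I : Type)
    (F : set_system I) {FF : Filter F} (f : I -> H) (l y : H) :
  f @ F --> l -> '[y, f i] @[i --> F] --> '[y, l].
Proof.
move=> fl.
have innerE (a b : H) : '[a, b] = 2^-1 * (`|a + b| ^+ 2 - `|a| ^+ 2 - `|b| ^+ 2).
  by rewrite !sqr_norm_inner innerDl !innerDr (innerC b a); field.
under eq_fun do rewrite innerE.
rewrite innerE; apply: cvgM; first exact: cvg_cst.
have sq (g : I -> H) m : g @ F --> m -> `|g i| ^+ 2 @[i --> F] --> `|m| ^+ 2.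
  by move=> gm; rewrite !expr2; apply: cvgM; exact: cvg_norm.
apply: cvgB; last exact: sq.
apply: cvgB; last exact: cvg_cst.
by apply: sq; apply: cvgD => //; exact: cvg_cst.
Qed.

Section orthonormal_quasimatrix.
Context {R : realType} {H : hilbertType R} {r : nat} (Q : 'I_r -> H).
Hypothesis Q1 : orthonormal_family Q.

Lemma inner_qop i xi : '[Q i, qop Q xi] = xi i 0.
Proof.
rewrite /qop inner_sumr (bigD1 i)//= innerZr Q1 eqxx mulr1 big1 ?addr0// => j ji.
by rewrite innerZr Q1 eq_sym (negbTE ji) mulr0.
Qed.

Lemma qopK : cancel (qop Q) (qadj Q).
Proof. by move=> xi; apply/matrixP => i j; rewrite ord1 mxE inner_qop. Qed.

(** For orthonormal [Q], the orthogonal projector onto the complement of its range. *)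
Definition residual (x : H) : H := x - qop Q (qadj Q x).

Lemma residual_is_linear : linear residual.
Proof.
move=> a x y; rewrite /residual /qop.
under eq_bigr do rewrite mxE innerDr innerZr scalerDl -scalerA.
rewrite big_split/= -scaler_sumr scalerBr opprD addrACA.
by under [in RHS]eq_bigr do rewrite mxE;
  under [X in _ = _ + (_ - X)]eq_bigr do rewrite mxE.
Qed.

HB.instance Definition _ :=
  GRing.isLinear.Build R H H *:%R residual residual_is_linear.

Lemma residual_qop xi : residual (qop Q xi) = 0.
Proof. by rewrite /residual qopK subrr. Qed.

Lemma inner_residual x i : '[Q i, residual x] = 0.
Proof. by rewrite /residual innerBr inner_qop mxE subrr. Qed.

Lemma norm_residual_le x : `|residual x| <= `|x|.
Proof.
rewrite -ler_sqr ?nnegrE//.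
have: '[residual x, qop Q (qadj Q x)] = 0.
  by rewrite inner_sumr big1// => i _; rewrite innerZr innerC inner_residual mulr0.
have: x = residual x + qop Q (qadj Q x) by rewrite subrK.
move: (residual x) (qop _ _) => y z -> yz0.
rewrite !sqr_norm_inner innerDl !innerDr yz0 innerC yz0 addr0 add0r.
by rewrite lerDl inner_ge0.
Qed.

Lemma residual_cvg (I : Type) (F : set_system I) {FF : Filter F} (f : I -> H)
    (l : H) :
  f @ F --> l -> residual (f i) @[i --> F] --> residual l.
Proof.
move=> fl; apply: cvgB => //; apply: (cvg_big (op := +%R)) => [|i _].
  exact: add_continuous.
by apply: cvgZr_tmp; rewrite mxE; under eq_fun do rewrite mxE; exact: inner_cvgr.
Qed.

End orthonormal_quasimatrix.

(** * Bounds on the Hilbert-Schmidt norm *)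

(** The basis [B] rules out the empty supremum -oo, so the supremum is nonnegative and squaring
    undoes [sqrte]. *)
Lemma sqr_hs_norm (R : realType) (V : innerType R) (W : normedModType R)
    (T : V -> W) (B : set V) : orthonormal_basis B ->
  (hs_norm T ^+ 2 = ereal_sup [set \esum_(b in B) (`|T b| ^+ 2)%:E
                              | B in @orthonormal_basis R V])%E.
Proof.
move=> onbB; apply: sqr_sqrte; apply: le_ereal_sup_tmp.
exists (\esum_(b in B) (`|T b| ^+ 2)%:E); first by exists B.
by apply: esum_ge0 => x _; rewrite lee_fin sqr_ge0.
Qed.

(** A sum over a basis is the supremum of its finite partial sums, each over a finite orthonormal
    family. *)
Lemma sqr_hs_norm_le (R : realType) (V : innerType R) (W : normedModType R)
    (T : V -> W) (M : \bar R) : (0 <= M)%E ->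
  (forall F : seq V, uniq F -> {in F &, forall x y, '[x, y] = (x == y)%:R} ->
    ((\sum_(b <- F) `|T b| ^+ 2)%:E <= M)%E) ->
  (hs_norm T ^+ 2 <= M)%E.
Proof.
move=> M0 TM.
(* With no basis the supremum is -oo, which [sqrte] sends to 0. *)
have [[B onbB]|noB] := pselect (exists B, @orthonormal_basis R V B); last first.
  suff -> : hs_norm T = 0%E by rewrite expe2 mule0.
  rewrite /hs_norm (_ : [set _ | _ in _] = set0) ?ereal_sup0//.
  by apply/seteqP; split => // x [B BB] _; case: noB; exists B.
rewrite (sqr_hs_norm _ onbB); apply: ge_ereal_sup => ? [C [C1 _] <-].
apply: ge_ereal_sup => ? [F [finF FC] <-].
rewrite fsbig_finite//= sumEFin; apply: TM => [|x y]; first exact: fset_uniq.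
by rewrite !in_fset_set// !inE => Fx Fy; rewrite C1//; exact: FC.
Qed.

(** On a finite orthonormal [F], [orthonormal_sum_le] bounds the partial sums of the series
    uniformly in n; as [F] is finite, the limit in n passes through the sum over [F]. *)
Lemma sqr_hs_norm_series_le (R : realType) (H1 H2 : hilbertType R)
    (T : H1 -> H2) (v : nat -> H1) (c : nat -> H2) : orthonormal_family v ->
  (forall x, series (fun i => '[v i, x] *: c i) @ \oo --> T x) ->
  (hs_norm T ^+ 2 <= \sum_(i <oo) (`|c i| ^+ 2)%:E)%E.
Proof.
move=> v1 Tc; apply: sqr_hs_norm_le.
  by apply: nneseries_ge0 => i _ _; rewrite lee_fin sqr_ge0.
move=> F uF F1.
set S := (\sum_(i <oo) _)%E.
have Tn : (\sum_(b <- F) `|series (fun i => '[v i, b] *: c i) n| ^+ 2)%:E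
    @[n --> \oo] --> (\sum_(b <- F) `|T b| ^+ 2)%:E.
  apply: cvg_EFin; first by near=> n.
  apply: (cvg_big (op := +%R)) => [|b _]; first exact: add_continuous.
  by rewrite expr2; under eq_fun do rewrite expr2; apply: cvgM; apply: cvg_norm;
    exact: Tc.
rewrite -(cvg_lim _ Tn)//; apply: lime_le.
  by apply/cvg_ex; eexists; exact: Tn.
near=> n; apply: (@le_trans _ _ (\sum_(0 <= i < n) (`|c i| ^+ 2)%:E)%E).
  rewrite sumEFin lee_fin; under eq_bigr do rewrite sqr_norm_inner.
  rewrite /series/=; under eq_bigr do rewrite big_mkord.
  under [leRHS]eq_bigr do rewrite sqr_norm_inner.
  by rewrite big_mkord; exact: orthonormal_sum_le.
by apply: nneseries_lim_ge => i _ _; rewrite lee_fin sqr_ge0.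
Unshelve. all: by end_near. Qed.

Lemma cv_inner_delta (R : realType) n i (y : 'cV[R]_n) :
  '[delta_mx i 0, y] = y i 0.
Proof.
rewrite [LHS](_ : _ = cv_inner (delta_mx i 0) y)// /cv_inner (bigD1 i)//=.
rewrite mxE !eqxx mul1r big1 ?addr0// => j ji.
by rewrite mxE (negbTE ji) mul0r.
Qed.

Lemma delta_mx_inj (R : realType) n : injective (fun i => delta_mx i 0 : 'cV[R]_n).
Proof.
move=> i j /(congr1 (fun M : 'cV_n => M i 0)); rewrite !mxE !eqxx andbT.
by case: eqVneq => // _ /eqP; rewrite oner_eq0.
Qed.

Lemma orthonormal_basis_delta (R : realType) n :
  @orthonormal_basis R 'cV[R]_n [set delta_mx i 0 | i in [set: 'I_n]].
Proof.
split=> [? ? [i _ <-] [j _ <-]|x x0].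
  by rewrite cv_inner_delta mxE eqxx andbT (inj_eq (@delta_mx_inj _ _)).
apply/matrixP => i j; rewrite ord1 mxE -cv_inner_delta; apply: x0.
by exists i.
Qed.

(** The standard basis is one competitor in the supremum. A lower bound suffices, since this norm
    stands on the larger side of the final estimate. *)
Lemma sqr_hs_norm_cV_ge (R : realType) (n : nat) (W : normedModType R)
    (T : 'cV[R]_n -> W) :
  ((\sum_(i < n) `|T (delta_mx i 0)| ^+ 2)%:E <= hs_norm T ^+ 2)%E.
Proof.
rewrite (sqr_hs_norm _ (@orthonormal_basis_delta R n)).
apply: le_ereal_sup_tmp; eexists.
  by exists [set delta_mx i 0 | i in [set: 'I_n]];
    [exact: orthonormal_basis_delta|].
apply: esum_ge; exists [set delta_mx i 0 | i in [set: 'I_n]].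
  by split => //; exact: finite_image.
rewrite fsbig_image; last by move=> i j _ _; exact: delta_mx_inj.
rewrite (_ : [set: 'I_n] = [set` index_enum 'I_n]).
  by rewrite -fsbig_seq ?index_enum_uniq// sumEFin.
by apply/seteqP; split => // i _ /=; exact: mem_index_enum.
Qed.

(** * Series along an orthonormal sequence *)

(** The squared norm of a block of the series is the sum of [a i ^+ 2] over that block, so the
    Cauchy criterion carries over. *)
Lemma cvg_orthonormal_series (R : realType) (H : hilbertType R) (u : nat -> H)
    (a : nat -> R) : orthonormal_family u ->
  cvgn (series (fun i => a i ^+ 2)) -> cvgn (series (fun i => a i *: u i)).
Proof.
move=> u1 /cauchy_cvgP/cauchy_seriesP a2.
apply/cauchy_cvgP/cauchy_seriesP => e e0.
apply: filterS (a2 _ (exprn_gt0 2 e0)) => -[m n] /=.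
rewrite ger0_norm ?sumr_ge0// => [amn|i _]; last exact: sqr_ge0.
rewrite -ltr_sqr ?nnegrE ?(ltW e0)// sqr_norm_inner inner_suml.
rewrite (le_lt_trans _ amn)// big_seq [leRHS]big_seq ler_sum// => i imn.
rewrite inner_sumr (bigD1_seq i) ?iota_uniq//= innerZl innerZr u1 eqxx.
rewrite big1 ?addr0 ?mulr1// => j ji.
by rewrite innerZl innerZr u1 eq_sym (negbTE ji) !mulr0.
Qed.

Lemma inner_orthonormal_series (R : realType) (H : hilbertType R) (u : nat -> H)
    (a : nat -> R) m : orthonormal_family u ->
  cvgn (series (fun i => a i *: u i)) ->
  '[u m, limn (series (fun i => a i *: u i))] = a m.
Proof.
move=> u1 ua.
have um : '[u m, series (fun i => a i *: u i) n] @[n --> \oo] -->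
    '[u m, limn (series (fun i => a i *: u i))] by exact: inner_cvgr.
rewrite -(cvg_lim _ um)//; apply: lim_near_cst => //.
near=> n; rewrite /series/= inner_sumr (bigD1_seq m) ?iota_uniq//=; last first.
  by rewrite mem_index_iota/=; near: n; exact: nbhs_infty_gt.
rewrite innerZr u1 eqxx mulr1 big1 ?addr0// => i im.
by rewrite innerZr u1 eq_sym (negbTE im) mulr0.
Unshelve. all: by end_near. Qed.

(** * The error bound for a fixed outcome *)

(** With a right inverse B of A and X the pseudoinverse, A X = A X A B = A B = 1. *)
Lemma mulmx_mp_inverse (R : realType) m n (A : 'M[R]_(m, n)) :
  row_free A -> A *m mp_inverse A = 1%:M.
Proof.
move=> /row_freeP[B AB]; have [AXA _ _ _] := mp_inverseP A.
by rewrite -[LHS]mulmx1 -AB mulmxA AXA.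
Qed.

(** Randomness enters only through [Ofree] and [uY], which are later shown to hold almost surely. *)
Lemma hs_error_le (R : realType) (H1 H2 : hilbertType R) (A : H1 -> H2)
    (sigma : nat -> R) (u : nat -> H2) (v : nat -> H1) (svdA : svd A sigma u v)
    (k l : nat) (Y : 'I_l -> H2) (Omega : 'M[R]_(k, l)) (Ofree : row_free Omega)
    (uY : forall (i : 'I_k) j, '[u i, Y j] = Omega i j * sigma i)
    (r : nat) (Q : 'I_r -> H2) (Q1 : orthonormal_family Q)
    (QY : range (qop Q) = range (qop Y)) :
  (hs_norm (A \- (qop Q \o qadj Q \o A)) ^+ 2 <=
    \sum_(k <= i <oo) (sigma i ^+ 2)%:E +
    hs_norm ((idfun \- (qop (fun i : 'I_k => u i) \o
      qadj (fun i : 'I_k => u i)))%R \o qop Y \o mulmx (mp_inverse Omega)) ^+ 2)%E.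
Proof.
set U := fun i : 'I_k => u i; set E := (_ \o mulmx _); have u1 := svd_left svdA.
pose Z (i : 'I_k) := qop Y (mp_inverse Omega *m delta_mx i 0).
have uZ (i j : 'I_k) : '[u i, Z j] = sigma i * (i == j)%:R.
  rewrite /Z inner_sumr; under eq_bigr do rewrite innerZr uY mulrCA mulrA mulrC.
  rewrite -mulr_sumr; congr (_ * _).
  transitivity ((Omega *m (mp_inverse Omega *m delta_mx j 0) : 'cV_k) i 0).
    by rewrite [RHS]mxE; apply: eq_bigr => j' _; rewrite mulrC.
  by rewrite mulmxA mulmx_mp_inverse// mul1mx mxE eqxx andbT.
have EZ i : E (delta_mx i 0) = Z i - sigma i *: u i.
  rewrite /E /= -/(Z i); congr (_ - _).
  rewrite /qop (bigD1 i)//= mxE uZ eqxx mulr1 big1 ?addr0// => j ji.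
  by rewrite mxE uZ (negbTE ji) mulr0 scale0r.
have QZ i : residual Q (Z i) = 0.
  have : range (qop Y) (Z i) by eexists.
  by rewrite -QY => -[xi _ <-]; rewrite residual_qop.
pose c i := residual Q (sigma i *: u i).
have cE (i : 'I_k) : `|c i| <= `|E (delta_mx i 0)|.
  rewrite (_ : c i = - residual Q (E (delta_mx i 0))) ?normrN ?norm_residual_le//.
  by rewrite EZ (linearB (residual Q))/= QZ sub0r opprK.
have cS i : `|c i| <= sigma i.
  rewrite (le_trans (norm_residual_le Q1 _))// normrZ (ger0_norm (svd_ge0 svdA i)).
  suff -> : `|u i| = 1 by rewrite mulr1.
  by apply/eqP; rewrite -sqrp_eq1// sqr_norm_inner u1 eqxx.
(* The residual map is linear and continuous, so it applies termwise to the singular value expansion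
   of [A]. *)
have Ac x : series (fun i => '[v i, x] *: c i) @ \oo -->
    (A \- (qop Q \o qadj Q \o A)) x.
  rewrite (_ : series _ =
      residual Q \o series (fun i => (sigma i * '[v i, x]) *: u i)).
    by apply: residual_cvg; exact: svdE svdA x.
  apply/funext => n /=; rewrite /series/= (linear_sum (residual Q))/=.
  apply: eq_bigr => i _.
  by rewrite /c !(linearZZ (residual Q))/= scalerA mulrC.
apply: (le_trans (sqr_hs_norm_series_le (svd_right svdA) Ac)).
(* Terms from k on are bounded by [cS], the first k by [cE]. *)
rewrite (nneseries_split 0 k); last by move=> i _; rewrite lee_fin sqr_ge0.
rewrite add0n addeC leeD//.
  apply: lee_nneseries => i _; rewrite lee_fin ?sqr_ge0//.
  by rewrite ler_sqr ?nnegrE// (svd_ge0 svdA).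
apply: le_trans (sqr_hs_norm_cV_ge E); rewrite sumEFin lee_fin big_mkord.
by apply: ler_sum => i _; rewrite ler_sqr ?nnegrE.
Qed.

(** * Independence of one variable from all the others *)

Section independence.
Context {d : measure_display} {T : measurableType d} {R : realType}.
Variables (P : probability T R) (I : choiceType) (X : I -> {RV P >-> R}).
Hypothesis indepX : mutually_independent X.
Variable i0 : I.

(* The finite-dimensional events not involving X i0. *)
Definition cylinders : set (set T) :=
  [set C | exists (S : {fset I}) (B : I -> set R),
    [/\ i0 \notin S, (forall i, measurable (B i)) &
        C = \bigcap_(i in [set` S]) (X i @^-1` B i)]].

Lemma measurable_cylinders : cylinders `<=` measurable.
Proof.
move=> _ [S [B [_ mB ->]]]; apply: fin_bigcap_measurable => // i _.
exact: measurable_funPTI.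
Qed.

Lemma cylinders_setI : setI_closed cylinders.
Proof.
move=> _ _ [S [B [i0S mB ->]]] [S' [B' [i0S' mB' ->]]].
(* Each family is padded with the whole line outside its own index set. *)
exists (S `|` S')%fset, (fun i => (if i \in S then B i else setT) `&`
  (if i \in S' then B' i else setT)); split.
- by rewrite inE negb_or i0S.
- by move=> i; apply: measurableI; case: ifP.
- apply/seteqP; split=> [w [wS wS'] i /= _|w wSS'].
    by split; case: ifP => // iS; [exact: wS|exact: wS'].
  split=> i /= iS; (have := wSS' i; rewrite /= inE iS ?orbT) => /(_ isT) [].
  + by [].
  + by [].
Qed.

Lemma cylinders_setT : cylinders setT.
Proof.
exists fset0, (fun=> setT); split=> //.
by apply/seteqP; split => // w _ i.
Qed.

Lemma cylinder_indep C B : measurable B -> cylinders C ->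
  (P (C `&` X i0 @^-1` B) = P C * P (X i0 @^-1` B))%E.
Proof.
move=> mB [S [D [i0S mD ->]]].
(* A single family serves both S and S with [i0] added; the change at [i0] is invisible on S. *)
pose D' i := if i == i0 then B else D i.
have D'0 : D' i0 = B by rewrite /D' eqxx.
have DD' i : i \in S -> D i = D' i.
  by rewrite /D'; case: eqP => // ->; rewrite (negbTE i0S).
have mD' i : measurable (D' i) by rewrite /D'; case: ifP.
have -> : \bigcap_(i in [set` S]) (X i @^-1` D i) =
    \bigcap_(i in [set` S]) (X i @^-1` D' i).
  by apply: eq_bigcapr => i /= iS; rewrite DD'.
rewrite -D'0 setIC.
rewrite -(bigcap_fsetU1 (fun i => X i @^-1` D' i)) !indepX// big_fsetU1//=.
exact: muleC.
Qed.

(** As functions of C, both sides are finite measures that agree on [cylinders], a family stable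
    under intersection and containing the whole space; hence they agree on the generated
    sigma-algebra. *)
Lemma sigma_cylinder_indep C B : measurable B -> <<s cylinders >> C ->
  (P (C `&` X i0 @^-1` B) = P C * P (X i0 @^-1` B))%E.
Proof.
move=> mB sC; have mXB : measurable (X i0 @^-1` B) by exact: measurable_funPTI.
have pB : P (X i0 @^-1` B) = (fine (P (X i0 @^-1` B)))%:E.
  by rewrite fineK// fin_num_measure.
have pB0 : 0 <= fine (P (X i0 @^-1` B)) by rewrite fine_ge0.
rewrite pB muleC.
apply: (g_sigma_algebra_measure_unique cylinders measurable_cylinders (fun=> setT)
  _ _ (mrestr P mXB) (mscale (NngNum pB0) P)) => //.
- by move=> _; exact: cylinders_setT.
- by rewrite bigcup_const.
- exact: cylinders_setI.
- move=> A /= /(cylinder_indep mB) PA.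
  by rewrite /mrestr PA /mscale/= -pB muleC.
- by move=> _; rewrite /= /mrestr setTI ltey_eq fin_num_measure.
Qed.

Lemma sigma_cylinder_measurable i : i != i0 ->
  measurable_fun setT (X i : g_sigma_algebraType cylinders -> R).
Proof.
move=> ii0 _ B mB; rewrite setTI; apply: sub_sigma_algebra.
exists [fset i]%fset, (fun=> B); split=> //; first by rewrite inE eq_sym.
by rewrite set_fset1 bigcap_set1.
Qed.

End independence.

(** * Almost sure full rank of the Gaussian block *)

Lemma affine_neq0_ae (d : measure_display) (T : measurableType d) (R : realType)
    (P : probability T R) (I : choiceType) (X : I -> {RV P >-> R}) (i0 : I)
    (a b : T -> R) :
  mutually_independent X ->
  (forall y, P (X i0 @^-1` [set y]) = 0%E) ->
  measurable_fun setT (a : g_sigma_algebraType (cylinders X i0) -> R) ->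
  measurable_fun setT (b : g_sigma_algebraType (cylinders X i0) -> R) ->
  \forall w \ae P, b w != 0 -> b w * X i0 w + a w != 0.
Proof.
(* X i0 is independent of the sigma-algebra generated by the cylinders, so the
   event has product measure zero by Fubini: its sections are points. *)
move=> indepX X0 ma mb; set G := cylinders X i0.
pose T1 := g_sigma_algebraType G.
have mG (A : set T1) : measurable A -> d.-measurable (A : set T).
  by apply: smallest_sub; [exact: sigma_algebra_measurable|
    exact: measurable_cylinders].
(* The identity into [T1], the same space with the smaller sigma-algebra, is a random variable that
   carries all the others; [f2] pairs it with [X i0]. *)
have mid : measurable_fun setT (id : T -> T1).
  by move=> _ B mB; rewrite setTI; exact: mG.
pose f1 : {mfun T >-> T1} := mfun_Sub (mem_set mid).
pose m1 := distribution P f1.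
pose m2 := distribution P (X i0).
have mpair : measurable_fun setT (fun w : T => (w : T1, X i0 w)).
  by apply: measurable_fun_pair.
pose f2 : {mfun T >-> (T1 * R)%type} := mfun_Sub (mem_set mpair).
pose S : set (T1 * R) := [set z | b z.1 != 0 /\ b z.1 * z.2 + a z.1 = 0].
have mb1 : measurable_fun setT (fun z : T1 * R => b z.1).
  by apply: measurableT_comp mb _.
have ma1 : measurable_fun setT (fun z : T1 * R => a z.1).
  by apply: measurableT_comp ma _.
have mS : measurable S.
  rewrite (_ : S = (fun z => (b z.1 != 0) && (b z.1 * z.2 + a z.1 == 0))
      @^-1` [set true]).
    rewrite -[X in measurable X]setTI; apply: measurable_and => //.
      by apply: measurable_neg; exact: measurable_fun_eqr.
    apply: measurable_fun_eqr => //; apply: measurable_funD => //.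
    exact: measurable_funM.
  by apply/seteqP; split=> z /=;
    [move=> [-> ->]; rewrite eqxx|move=> /andP[? /eqP]].
have PS : P (f2 @^-1` S) = 0%E.
  (* Independence makes the law of [f2] the product of [m1] and [m2]. *)
  rewrite -[LHS]/(distribution P f2 S) -(@product_measure_unique _ _ _ _ _ m1 m2)//.
    rewrite /product_measure1; apply: integral0_eq => w _ /=.
    apply/eqP; rewrite eq_le measure_ge0 andbT.
    apply: (@le_trans _ _ (m2 [set - a w / b w])); last first.
      by rewrite /m2 /distribution /pushforward X0.
    apply: le_measure; rewrite ?inE//; first exact: measurable_xsection.
    move=> x /=; rewrite /xsection/= inE => -[/= bw0 /eqP].
    by rewrite addr_eq0 => /eqP <-; rewrite mulrC mulKf.
  by move=> A B mA mB; exact: (sigma_cylinder_indep indepX mB mA).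
exists (f2 @^-1` S); split => [||w /= /not_implyP[bw /negP]] //.
  exact: measurable_funPTI.
by rewrite negbK => /eqP.
Qed.

Lemma measurable_det (d : measure_display) (T : measurableType d) (R : realType)
    n (M : T -> 'M[R]_n) :
  (forall i j, measurable_fun setT (fun w => M w i j)) ->
  measurable_fun setT (fun w => \det (M w)).
Proof.
move=> mM; apply: measurable_sum => s; apply: measurable_funM => //.
by apply: measurable_prod => i _; exact: mM.
Qed.

(** Expansion along the last row, arranged to isolate the affine dependence on the corner entry. *)
Lemma det_last_entry (R : comNzRingType) n (M : 'M[R]_n.+1) :
  \det M =
  \det (\matrix_(i < n, j < n) M (widen_ord (leqnSn n) i)
                                 (widen_ord (leqnSn n) j)) * M ord_max ord_max +
  \det (\matrix_(i, j) if (i == ord_max) && (j == ord_max) then 0 else M i j).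
Proof.
set N := \matrix_(i, j) if _ then _ else _.
(* Cofactors of the last row do not involve that row, and only there do [M] and [N] differ. *)
have cofN j : cofactor M ord_max j = cofactor N ord_max j.
  rewrite /cofactor; congr (_ * \det _); apply/matrixP => a b; rewrite !mxE.
  by rewrite eq_sym (negbTE (neq_lift _ _)).
rewrite (expand_det_row M ord_max) (expand_det_row N ord_max).
rewrite (bigD1 ord_max)//= [X in _ = _ + X](bigD1 ord_max)//= [N _ _]mxE.
rewrite !eqxx mul0r add0r; congr (_ + _).
  rewrite mulrC; congr (_ * _); rewrite /cofactor -signr_odd oddD addbb mul1r.
  congr (\det _); apply/matrixP => a b; rewrite !mxE.
  by congr (M _ _); apply: val_inj; rewrite /= /bump leqNgt ltn_ord.
by apply: eq_bigr => j jm; rewrite cofN mxE (negbTE jm) andbF.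
Qed.

(** By induction on the size: the next minor is affine in its corner entry, with slope the previous
    minor, which is almost surely nonzero. *)
Lemma leading_minor_neq0_ae (d : measure_display) (T : measurableType d)
    (R : realType) (P : probability T R) l (X : nat * 'I_l -> {RV P >-> R}) :
  mutually_independent X ->
  (forall i y, P (X i @^-1` [set y]) = 0%E) ->
  forall m (ml : (m <= l)%N), \forall w \ae P,
    \det (\matrix_(i < m, j < m) X (i : nat, widen_ord ml j) w) != 0.
Proof.
move=> indepX X0; elim => [|m IH] ml.
  by apply: aeW => w; rewrite det_mx00 oner_neq0.
pose M w : 'M[R]_m.+1 := \matrix_(i, j) X (i : nat, widen_ord ml j) w.
pose N w := \matrix_(i, j)
  if (i == ord_max) && (j == ord_max) then 0 else M w i j.
pose K w := \matrix_(i < m, j < m) M w (widen_ord (leqnSn m) i)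
                                       (widen_ord (leqnSn m) j).
pose i0 := (m, widen_ord ml ord_max).
have /= affine : \forall w \ae P, \det (K w) != 0 ->
    \det (K w) * X i0 w + \det (N w) != 0.
  (* Both coefficients avoid the variable at [i0]: [N] has 0 in the corner, and the rows of [K] have
     index below m. *)
  apply: affine_neq0_ae => //.
    apply: measurable_det => i j; rewrite /N; under eq_fun do rewrite !mxE.
    case: (boolP ((i == ord_max) && (j == ord_max))) => [_|ijm].
      exact: measurable_cst.
    apply: sigma_cylinder_measurable; apply: contra ijm => /eqP[im jm].
    by rewrite -!val_eqE/= im jm !eqxx.
  apply: measurable_det => i j; rewrite /K; under eq_fun do rewrite !mxE.
  apply: sigma_cylinder_measurable; apply/eqP => -[im _].
  by have := ltn_ord i; rewrite [X in (X < _)%N]im ltnn.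
apply: filterS2 affine (IH (ltnW ml)) => w Kw Dw.
rewrite [X in \det X](_ : _ = M w)// det_last_entry [M w ord_max ord_max]mxE.
apply: Kw; rewrite (_ : K w =
  \matrix_(i < m, j < m) X (i : nat, widen_ord (ltnW ml) j) w)//.
apply/matrixP => i j; rewrite !mxE; congr (X (_, _) _); exact: val_inj.
Qed.

(** * Gaussian second moments and convergence of the columns *)

Lemma standard_normal_set1 (d : measure_display) (T : measurableType d)
    (R : realType) (P : probability T R) (X : {RV P >-> R}) y :
  standard_normal X -> P (X @^-1` [set y]) = 0%E.
Proof.
move=> normX; rewrite -[LHS]/(distribution P X [set y]) normX//.
have /null_content_dominatesP := @normal_prob_dominates R 0 1; apply => //.
exact: lebesgue_measure_set1.
Qed.

(** The Radon-Nikodym derivative of the normal law and the explicit density have equal integrals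
    over measurable sets, hence agree almost everywhere. *)
Lemma ge0_integral_normal_prob (R : realType) (m s : R) (f : R -> \bar R) :
  measurable_fun setT f -> (forall x, 0 <= f x)%E ->
  (\int[normal_prob m s]_x f x =
   \int[lebesgue_measure]_x (f x * (normal_pdf m s x)%:E))%E.
Proof.
move=> mf f0; have dom := @normal_prob_dominates R m s.
rewrite -(Radon_Nikodym_SigmaFinite.change_of_variables dom)//.
have mRN : lebesgue_measure.-integrable setT
    (Radon_Nikodym_SigmaFinite.f (normal_prob m s) lebesgue_measure).
  exact: Radon_Nikodym_SigmaFinite.f_integrable.
have mpdf : measurable_fun setT (fun x => (normal_pdf m s x)%:E).
  by apply/measurable_EFinP; exact: measurable_normal_pdf.
apply: ae_eq_integral => //.
- by apply: emeasurable_funM => //; exact: measurable_int mRN.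
- exact: emeasurable_funM.
- apply: ae_eqe_mul2l; apply: integral_ae_eq => // E _ mE.
  by rewrite -Radon_Nikodym_SigmaFinite.f_integral.
Qed.

(** [C] is chosen before [X], so that one bound serves every term of a series. *)
Lemma standard_normal_sqr_lty (d : measure_display) (T : measurableType d)
    (R : realType) (P : probability T R) :
  exists2 C : R, 0 <= C & forall X : {RV P >-> R}, standard_normal X ->
    (\int[P]_w (X w ^+ 2)%:E <= C%:E)%E.
Proof.
(* Chosen so that x^2 times the standard density is at most [C] times the density of standard
   deviation 2: 8/3 compares the exponentials, the peaks the normalizations. *)
pose C : R := 8 / 3 * normal_peak 1 / normal_peak 2.
have pk2 : 0 < normal_peak (2 : R) by exact: normal_peak_gt0.
exists C; first by rewrite !mulr_ge0 ?invr_ge0 ?normal_peak_ge0// ltW.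
move=> X normX.
have msqr : measurable_fun setT (fun x : measurableTypeR R => (x ^+ 2)%:E).
  by apply/measurable_EFinP; exact: measurable_funX.
have sqr0 (x : R) : (0 <= (x ^+ 2)%:E)%E by rewrite lee_fin sqr_ge0.
have mX : measurable_fun setT (X : T -> measurableTypeR R).
  exact: (@measurable_funPT _ _ _ _ X).
have -> : (\int[P]_w (X w ^+ 2)%:E = \int[normal_prob 0 1]_x (x ^+ 2)%:E)%E.
  transitivity (\int[pushforward P (X : T -> measurableTypeR R)]_x (x ^+ 2)%:E)%E.
    by rewrite ge0_integral_pushforward.
  by apply: eq_measure_integral => A mA _; exact: normX.
rewrite ge0_integral_normal_prob//.
have <- : (\int[lebesgue_measure]_x (C%:E * (normal_pdf 0 2 x)%:E) = C%:E)%E.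
  rewrite integralZl//; last exact: integrable_normal_pdf.
  by rewrite integral_normal_pdf mule1.
apply: ge0_le_integral => //=.
- by move=> x _; rewrite mule_ge0// lee_fin normal_pdf_ge0.
- apply: emeasurable_funM => //; apply/measurable_EFinP.
  exact: measurable_normal_pdf.
- apply: emeasurable_funM => //; apply/measurable_EFinP.
  exact: measurable_normal_pdf.
move=> x _; rewrite -!EFinM lee_fin !normal_pdfE ?pnatr_eq0 ?oner_eq0//.
rewrite /C /normal_fun !subr0.
rewrite -[leRHS]mulrA mulKf ?gt_eqF//.
rewrite mulrCA -[leRHS]mulrA [leRHS]mulrCA; apply: ler_wpM2l.
  exact: normal_peak_ge0.
have -> : - x ^+ 2 / (2 ^+ 2 *+ 2) = 3 / 8 * x ^+ 2 + - x ^+ 2 / (1 ^+ 2 *+ 2).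
  by field.
(* x^2 e^(-x^2/2) <= (8/3) e^(-x^2/8), from t <= e^t at t = 3x^2/8 *)
rewrite expRD mulrA; apply: ler_wpM2r; first exact: expR_ge0.
have := expR_ge1Dx (3 / 8 * x ^+ 2); lra.
Qed.

Lemma nneseries_tail_pinfty (R : realType) (f : nat -> \bar R) k :
  (forall i, 0 <= f i < +oo)%E -> (\sum_(i <oo) f i = +oo)%E ->
  (\sum_(k <= i <oo) f i = +oo)%E.
Proof.
move=> f0; rewrite (nneseries_split 0 k); last by move=> i _; case/andP: (f0 i).
rewrite add0n; apply: contraPP => tail; apply/eqP; rewrite lt_eqF//.
rewrite lte_add_pinfty//; first by apply: lte_sum_pinfty => i _; case/andP: (f0 i).
by rewrite ltey; apply/eqP.
Qed.

(** The expected sum is at most [C] times the sum of [sigma i ^+ 2], hence finite, and an integrable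
    sum is almost surely finite. *)
Lemma standard_normal_series_cvg_ae (d : measure_display) (T : measurableType d)
    (R : realType) (P : probability T R) (X : nat -> {RV P >-> R})
    (sigma : nat -> R) :
  (forall i, standard_normal (X i)) -> (\sum_(i <oo) (sigma i ^+ 2)%:E < +oo)%E ->
  \forall w \ae P, cvgn (series (fun i => (X i w * sigma i) ^+ 2)).
Proof.
move=> normX sigma2; have [C C0 XC] := standard_normal_sqr_lty P.
pose f i w : \bar R := ((X i w * sigma i) ^+ 2)%:E.
have f0 i w : (0 <= f i w)%E by rewrite lee_fin sqr_ge0.
have mf i : measurable_fun setT (f i).
  by apply: measurableT_comp => //; apply: measurable_funX; exact: measurable_funM.
have mS : measurable_fun setT (fun w => \sum_(i <oo) f i w)%E.
  by apply: ge0_emeasurable_sum.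
have : P.-integrable setT (fun w => \sum_(i <oo) f i w)%E.
  apply/integrableP; split => //.
  under eq_integral do rewrite gee0_abs ?nneseries_ge0//.
  rewrite integral_nneseries//.
  apply: (@le_lt_trans _ _ (\sum_(i <oo) C%:E * (sigma i ^+ 2)%:E)%E).
    apply: lee_nneseries => [i _ _|i _]; first exact: integral_ge0.
    under eq_integral do rewrite /f exprMn mulrC EFinM.
    rewrite ge0_integralZl// ?lee_fin ?sqr_ge0// => [||x _]; last first.
    - by rewrite lee_fin sqr_ge0.
    - by apply/measurable_EFinP; exact: measurable_funX.
    by rewrite muleC lee_wpmul2r ?lee_fin ?sqr_ge0// XC.
  rewrite nneseriesZl; last by move=> i _; rewrite lee_fin sqr_ge0.
  by rewrite lte_mul_pinfty ?lee_fin.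
move=> /(integrable_ae measurableT); apply: filterS => w /(_ I) fin.
by apply: nnseries_is_cvg => [i|]; rewrite ?sqr_ge0// ltey_eq fin.
Qed.

(** * The almost sure error bound *)

Theorem lemma1 (R : realType) (H1 H2 : hilbertType R)
    (sepH1 : separable H1) (sepH2 : separable H2)
    (infH1 : infinite_dimensional H1) (infH2 : infinite_dimensional H2)
    (A : {linear H1 -> H2}) (hsA : hilbert_schmidt A)
    (sigma : nat -> R) (u : nat -> H2) (v : nat -> H1)
    (svdA : svd A sigma u v)
    (k p : nat) (k_ge1 : (1 <= k)%N)
    (d : measure_display) (T : measurableType d) (P : probability T R)
    (omega : nat * 'I_(k + p) -> {RV P >-> R})
    (iid_omega : iid_standard_normal omega) :
  let Y := sketch omega sigma u in
  let Omega := omega_mx k omega in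
  let U := fun i : 'I_k => u i in
  \forall w \ae P, forall (r : nat) (Q : 'I_r -> H2),
    orthonormal_family Q -> range (qop Q) = range (qop (Y w)) ->
    let Ahat := qop Q \o qadj Q \o A in
    let E := (idfun \- (qop U \o qadj U)) \o qop (Y w)
             \o mulmx (mp_inverse (Omega w)) in
    (hs_norm (A \- Ahat) ^+ 2 <=
      \sum_(k <= i <oo) (sigma i ^+ 2)%:E + hs_norm E ^+ 2)%E.
Proof.
move=> Y Omega U; have [indep normal] := iid_omega; have u1 := svd_left svdA.
have sigma2_ge0 i : (0 <= (sigma i ^+ 2)%:E)%E by rewrite lee_fin sqr_ge0.
(* The infinite case contradicts hsA, but the bound is then trivial. *)
have [sigma2|sigma2] := eqVneq (\sum_(i <oo) (sigma i ^+ 2)%:E)%E +oo%E.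
  apply: aeW => w r Q _ _ /=; rewrite nneseries_tail_pinfty//; last first.
    by move=> i; rewrite sigma2_ge0 ltry.
  by rewrite addye ?leey// -ltNye (@lt_le_trans _ _ 0%E)// mule_ge0// sqrte_ge0.
(* There are finitely many columns, so the union of their exceptional sets is null. *)
have cvgY : \forall w \ae P, forall j,
    cvgn (series (fun i => (omega (i, j) w * sigma i) ^+ 2)).
  apply: filter_forall => j.
  apply: (standard_normal_series_cvg_ae (X := fun i => omega (i, j))) => //.
  by rewrite ltey.
have minor := leading_minor_neq0_ae indep
  (fun i y => standard_normal_set1 y (normal i)) (leq_addr p k).
(* Both events are fixed before [Q], so one null set serves every [Q]. *)
apply: filterS2 cvgY minor => w cvgY minor r Q Q1 QY /=.
apply: (hs_error_le svdA _ _ Q1 QY).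
  apply/row_freeP.
  (* The first k columns of [Omega w] form the nonsingular [M]; selecting them and applying its
     inverse gives a right inverse. *)
  set M := \matrix_(i, j) _ in minor.
  have MO : M = Omega w *m colsub (widen_ord (leq_addr p k)) 1%:M.
    by rewrite mulmx_colsub mulmx1; apply/matrixP => i j; rewrite !mxE.
  exists (colsub (widen_ord (leq_addr p k)) 1%:M *m invmx M).
  by rewrite mulmxA -MO mulmxV// unitmxE unitfE.
(* Square summability makes the column series converge, so [limn] is its true sum and not a default
   value. *)
move=> i j; rewrite /Y /sketch inner_orthonormal_series ?mxE//.
by apply: cvg_orthonormal_series.
Qed.
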